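(* For every single-coalition-first action model $M$ and single-coalition-first neighborhood model $N$, if $M$ is $z$-representable by $N$, then for every $X\in ES$, $M$ is an $X$-model if and only if $N$ is an $X$-model.
   Context: $AG$ is a finite nonempty set of agents, $AP$ a countable set of atomic propositions. For a nonempty set $AC$ and $C\subseteq AG$, $JA_C$ is the set of functions $\sigma_C:C\to AC$ ($JA_\emptyset=\{\emptyset\}$); $\sigma_C|_{\{a\}}$ is the restriction to $\{a\}$; for disjoint $C,D$, $\sigma_C\cup\sigma_D\in JA_{C\cup D}$. A single-coalition-first action model is $M=(ST,AC,suc,\{out_a\}_{a\in AG},L)$ with $ST,AC$ nonempty, $suc:ST\to\mathcal P(ST)$, $out_a:ST\times JA_{\{a\}}\to\mathcal P(ST)$ with $\bigcup\{out_a(s,\sigma_a)\mid\sigma_a\in JA_{\{a\}}\}=suc(s)$ for all $s$, $L:ST\to\mathcal P(AP)$. It determines $out_\emptyset(s,\emptyset)=suc(s)$, $out_C(s,\sigma_C)=\bigcap\{out_a(s,\sigma_C|_{\{a\}})\mid a\in C\}$ for nonempty $C$, $av_C(s)=\{\sigma_C\mid out_C(s,\sigma_C)\neq\emptyset\}$, $AE_C(s)=\{out_C(s,\sigma_C)\mid\sigma_C\in av_C(s)\}$. $M$ is serial if $av_C(s)\neq\emptyset$ for all $C,s$; independent if for all $s$, disjoint $C,D$, $\sigma_C\in av_C(s)$, $\sigma_D\in av_D(s)$: $\sigma_C\cup\sigma_D\in av_{C\cup D}(s)$; deterministic if $out_{AG}(s,\sigma_{AG})$ is a singleton for all $s$ and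 $\sigma_{AG}\in av_{AG}(s)$. A single-coalition-first neighborhood model is $N=(ST,suc,\{nei_a\}_{a\in AG},L)$ with $suc:ST\to\mathcal P(ST)$, $nei_a(s)\subseteq\mathcal P(ST)$ a cover of $suc(s)$ (union $suc(s)$, $\emptyset\notin nei_a(s)$). With $\Delta_1\odot\Delta_2=\{Y_1\cap Y_2\mid Y_i\in\Delta_i,Y_1\cap Y_2\neq\emptyset\}$ (extended to finitely many families, $\bigodot\{\Delta\}=\Delta$): $nei_C(s)=\emptyset$ if $suc(s)=\emptyset$; $\{suc(s)\}$ if $suc(s)\neq\emptyset$, $C=\emptyset$; $\bigodot\{nei_a(s)\mid a\in C\}$ otherwise. $N$ is serial if $nei_C(s)\neq\emptyset$ for all $C,s$; independent if for all $s$, disjoint $C,D$, $Y_1\in nei_C(s)$, $Y_2\in nei_D(s)$: $Y_1\cap Y_2\neq\emptyset$; deterministic if every $Y\in nei_{AG}(s)$ is a singleton. $ES=\{\epsilon,\mathtt S,\mathtt I,\mathtt D,\mathtt{SI},\mathtt{SD},\mathtt{ID},\mathtt{SID}\}$; a model is an $X$-model if it has the properties whose letters ($\mathtt S$ serial, $\mathtt I$ independent, $\mathtt D$ deterministic) occur in $X$. $M$ is $z$-representable by $N$ if they share $ST$ and $L$ and $AE_C=nei_C$ for all $C\subseteq AG$. *)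

(* Defs.v *)
From mathcomp Require Import all_boot.
From mathcomp Require Import boolp classical_sets.

Set Implicit Arguments.
Unset Strict Implicit.
Unset Printing Implicit Defensive.

Local Open Scope classical_set_scope.

Section JointActions.
Variables (AG : finType) (AC : Type).
Implicit Types C D : {set AG}.

Definition JA C : Type := {a : AG | a \in C} -> AC.

Definition restrict C D (sub : D \subset C) (sigma : JA C) : JA D :=
  fun a => sigma (exist _ (val a) (fintype.subsetP sub _ (valP a))).

Fact singleton_sub C (a : {a : AG | a \in C}) : [set val a]%SET \subset C.
Proof. by rewrite finset.sub1set; exact: valP a. Qed.

Definition restrict1 C (sigma : JA C) (a : {a : AG | a \in C}) :
    JA [set val a]%SET :=
  restrict (singleton_sub a) sigma.

Fact union_notin C D (a : AG) : a \in C :|: D -> ~~ (a \in C) -> a \in D.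
Proof. by rewrite finset.inE => /orP[-> //|]. Qed.

(* On C :&: D the left argument wins; the union is only used for disjoint
   C and D. *)
Definition JA_union C D (sigma : JA C) (tau : JA D) : JA (C :|: D) :=
  fun a => match boolP (val a \in C) with
           | AltTrue aC => sigma (exist _ (val a) aC)
           | AltFalse aNC => tau (exist _ (val a) (union_notin (valP a) aNC))
           end.

End JointActions.

Arguments restrict1 {AG AC C} sigma a.

Section ActionModels.
Variables (AG : finType) (AP : countType) (ST AC : Type).

Record action_model := ActionModel {
  am_ST_nonempty : inhabited ST;
  am_AC_nonempty : inhabited AC;
  am_suc : ST -> set ST;
  am_out : forall a : AG, ST -> JA AC [set a]%SET -> set ST;
  am_out_suc : forall a s,
    \bigcup_(sigma : JA AC [set a]%SET) am_out s sigma = am_suc s;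
  am_label : ST -> set AP
}.
Arguments am_out : clear implicits.

Variable M : action_model.
Implicit Types (C D : {set AG}) (s : ST).

Definition out C s (sigma : JA AC C) : set ST :=
  if C == finset.set0 then am_suc M s
  else \bigcap_(a : {a : AG | a \in C}) am_out M (val a) s (restrict1 sigma a).

Definition av C s : set (JA AC C) := [set sigma | out s sigma != set0].

Definition AE C s : set (set ST) := [set out s sigma | sigma in @av C s].

Definition am_serial : Prop := forall C s, @av C s != set0.

Definition am_independent : Prop :=
  forall s C D, [disjoint C & D]%B ->
  forall (sigma : JA AC C) (tau : JA AC D),
    av s sigma -> av s tau -> av s (JA_union sigma tau).

Definition am_deterministic : Prop :=
  forall s (sigma : JA AC [set: AG]%SET),
    av s sigma -> exists t, out s sigma = [set t].

End ActionModels.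

Definition odot (T : Type) (Delta1 Delta2 : set (set T)) : set (set T) :=
  [set Y | exists Y1 Y2,
     [/\ Delta1 Y1, Delta2 Y2, Y1 `&` Y2 != set0 & Y = Y1 `&` Y2]].

(* The extension of odot to a nonempty finite list of families; the value on
   the empty list is a dummy.  The operation odot is associative and
   commutative, so the order of the list is irrelevant, but it is not
   idempotent, so repeated families do matter. *)
Fixpoint bigodot (T : Type) (l : seq (set (set T))) : set (set T) :=
  match l with
  | [::] => set0
  | [:: Delta] => Delta
  | Delta :: l' => odot Delta (bigodot l')
  end.

Section NeighborhoodModels.
Variables (AG : finType) (AP : countType) (ST : Type).

Record neighborhood_model := NeighborhoodModel {
  nm_ST_nonempty : inhabited ST;
  nm_suc : ST -> set ST;
  nm_nei : AG -> ST -> set (set ST);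
  nm_nei_cover : forall a s, \bigcup_(Y in nm_nei a s) Y = nm_suc s;
  nm_nei_nonempty : forall a s, ~ nm_nei a s set0;
  nm_label : ST -> set AP
}.

Variable N : neighborhood_model.
Implicit Types (C D : {set AG}) (s : ST).

(* The neighborhoods of the members of C are combined as a family indexed by
   C: two agents with the same neighborhoods still choose independently. *)
Definition nei C s : set (set ST) :=
  if `[< nm_suc N s = set0 >] then set0
  else if C == finset.set0 then [set nm_suc N s]
  else bigodot [seq nm_nei N a s | a <- enum C].

Definition nm_serial : Prop := forall C s, nei C s != set0.

Definition nm_independent : Prop :=
  forall s C D, [disjoint C & D]%B ->
  forall Y1 Y2, nei C s Y1 -> nei D s Y2 -> Y1 `&` Y2 != set0.

Definition nm_deterministic : Prop :=
  forall s Y, nei [set: AG]%SET s Y -> exists t, Y = [set t].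

End NeighborhoodModels.

Inductive property := Serial | Independent | Deterministic.

Inductive ES := ES_eps | ES_S | ES_I | ES_D | ES_SI | ES_SD | ES_ID | ES_SID.

Definition letters (X : ES) : set property :=
  match X with
  | ES_eps => set0
  | ES_S => [set Serial]
  | ES_I => [set Independent]
  | ES_D => [set Deterministic]
  | ES_SI => [set Serial; Independent]
  | ES_SD => [set Serial; Deterministic]
  | ES_ID => [set Independent; Deterministic]
  | ES_SID => [set Serial; Independent; Deterministic]
  end.

Section XModels.
Variables (AG : finType) (AP : countType) (ST AC : Type).

Definition am_has (M : action_model AG AP ST AC) (p : property) : Prop :=
  match p with
  | Serial => am_serial M
  | Independent => am_independent M
  | Deterministic => am_deterministic M
  end.

Definition nm_has (N : neighborhood_model AG AP ST) (p : property) : Prop :=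
  match p with
  | Serial => nm_serial N
  | Independent => nm_independent N
  | Deterministic => nm_deterministic N
  end.

Definition is_action_X_model (X : ES) (M : action_model AG AP ST AC) : Prop :=
  forall p, letters X p -> am_has M p.

Definition is_neighborhood_X_model (X : ES)
    (N : neighborhood_model AG AP ST) : Prop :=
  forall p, letters X p -> nm_has N p.

(* Both models have the same type ST of states by typing. *)
Definition z_representable (M : action_model AG AP ST AC)
    (N : neighborhood_model AG AP ST) : Prop :=
  am_label M = nm_label N /\ forall C : {set AG}, AE M C = nei N C.

End XModels.

(* Main.v *)
(** An action model and the neighborhood model representing it share the sets
    [AE M C s = nei N C s], and each of the three properties of [M] can be read
    off these sets.  For seriality and determinism this is immediate; for
    independence, the outcome of the union of two disjoint joint actions is the
    intersection of their outcomes. *)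

Require Import Defs.
From mathcomp Require Import all_boot.
From mathcomp Require Import boolp classical_sets.

Set Implicit Arguments.
Unset Strict Implicit.
Unset Printing Implicit Defensive.

Local Open Scope classical_set_scope.

Section JointActionUnion.
Variables (AG : finType) (AC : Type) (C D : {set AG}).
Variables (sigma : JA AC C) (tau : JA AC D).

(** The branch selected by [boolP] carries its own membership proof; it is identified with the given
    [aC] because proofs of a boolean equality are unique. *)
Lemma JA_unionl (a : {a | a \in C :|: D}) (aC : val a \in C) :
  JA_union sigma tau a = sigma (exist _ (val a) aC).
Proof.
rewrite /JA_union; case: {-}_ / boolP => [aC'|/negP//].
by rewrite (bool_irrelevance aC' aC).
Qed.

Lemma JA_unionr (CD : [disjoint C & D]%B) (a : {a | a \in C :|: D})
  (aD : val a \in D) : JA_union sigma tau a = tau (exist _ (val a) aD).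
Proof.
rewrite /JA_union; case: {-}_ / boolP => [aC|aNC].
  by have := disjointFr CD aC; rewrite aD.
by congr tau; congr exist; exact: bool_irrelevance.
Qed.

Lemma restrict1_unionl a (aCD : a \in C :|: D) (aC : a \in C) :
  restrict1 (JA_union sigma tau) (exist _ a aCD) = restrict1 sigma (exist _ a aC).
Proof.
apply: funext => -[b ba]; rewrite /restrict1 /restrict /=.
(* Both sides are functions on the singleton of [a], so [b] equals [a]. *)
have bC : b \in C by move: (ba); rewrite finset.in_set1 => /eqP->.
rewrite (JA_unionl (a := exist _ b _) bC).
by congr sigma; congr exist; exact: bool_irrelevance.
Qed.

Lemma restrict1_unionr (CD : [disjoint C & D]%B) a (aCD : a \in C :|: D)
    (aD : a \in D) :
  restrict1 (JA_union sigma tau) (exist _ a aCD) = restrict1 tau (exist _ a aD).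
Proof.
apply: funext => -[b ba]; rewrite /restrict1 /restrict /=.
have bD : b \in D by move: (ba); rewrite finset.in_set1 => /eqP->.
rewrite (JA_unionr CD (a := exist _ b _) bD).
by congr tau; congr exist; exact: bool_irrelevance.
Qed.

End JointActionUnion.

Section ActionModelProperties.
Variables (AG : finType) (AP : countType) (ST AC : Type).
Variable M : action_model AG AP ST AC.
Implicit Types (C D : {set AG}) (s t : ST).

(** Treats empty and nonempty coalitions uniformly: for empty [C] the second conjunct is vacuous,
    and for nonempty [C] it implies the first. *)
Lemma outP C s (sigma : JA AC C) t :
  out M s sigma t <->
  am_suc M s t /\
  forall a : {a | a \in C}, am_out (a := val a) M s (restrict1 sigma a) t.
Proof.
rewrite /out; case: eqP => [C0|/eqP/finset.set0Pn[a aC]].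
  by split=> [st|[]//]; split=> // -[a aC]; exfalso; move: aC; rewrite C0 finset.in_set0.
split=> [outt|[_ outt] b _ //]; split=> [|b]; last exact: (outt b).
(* The successors of [s] are the union of the outcomes of [a], and [t] lies in the outcome of the
   action that [sigma] gives to [a]. *)
rewrite -(am_out_suc M a s).
by exists (restrict1 sigma (exist _ a aC)) => //; exact: (outt (exist _ a aC)).
Qed.

(** By [outP], outcomes are determined agent by agent, and each agent of the union acts as in
    [sigma] or as in [tau]. *)
Lemma out_union C D s (sigma : JA AC C) (tau : JA AC D) :
  [disjoint C & D]%B ->
  out M s (JA_union sigma tau) = out M s sigma `&` out M s tau.
Proof.
move=> CD; apply/seteqP; split=> [t /outP[st outt]|t [/outP[st outC] /outP[_ outD]]].
  split; apply/outP; split=> // -[a aX] /=.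
    have aCD : a \in C :|: D by rewrite finset.in_setU aX.
    by rewrite -(restrict1_unionl sigma tau aCD); exact: (outt (exist _ a aCD)).
  have aCD : a \in C :|: D by rewrite finset.in_setU aX orbT.
  by rewrite -(restrict1_unionr sigma tau CD aCD); exact: (outt (exist _ a aCD)).
apply/outP; split=> // -[a aCD] /=.
case/finset.setUP: (aCD) => [aC|aD].
  by rewrite (restrict1_unionl _ _ _ aC); exact: (outC (exist _ a aC)).
by rewrite (restrict1_unionr _ _ CD _ aD); exact: (outD (exist _ a aD)).
Qed.

Lemma am_serialP : am_serial M <-> forall C s, AE M C s != set0.
Proof.
split=> ser C s; apply/set0P; have /set0P := ser C s.
  by case=> sigma av_sigma; exists (out M s sigma), sigma.
by case=> _ [sigma av_sigma _]; exists sigma.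
Qed.

(** By [out_union], the union of two disjoint joint actions is available exactly when their outcomes
    meet. *)
Lemma am_independentP : am_independent M <->
  forall s C D, [disjoint C & D]%B ->
  forall Y1 Y2, AE M C s Y1 -> AE M D s Y2 -> Y1 `&` Y2 != set0.
Proof.
split=> ind s C D CD.
  move=> _ _ [sigma av_sigma <-] [tau av_tau <-].
  by rewrite -out_union//; exact: ind.
move=> sigma tau av_sigma av_tau; rewrite /av /= out_union//.
by apply: (ind s C D CD); [exists sigma|exists tau].
Qed.

Lemma am_deterministicP : am_deterministic M <->
  forall s Y, AE M [set: AG]%SET s Y -> exists t, Y = [set t].
Proof.
split=> det s; first by move=> _ [sigma av_sigma <-]; exact: det.
by move=> sigma av_sigma; apply: (det s); exists sigma.
Qed.

End ActionModelProperties.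

Lemma z_representable_has (AG : finType) (AP : countType) (ST AC : Type)
    (M : action_model AG AP ST AC) (N : neighborhood_model AG AP ST) p :
  z_representable M N -> am_has M p <-> nm_has N p.
Proof.
(* As an equality of functions, [AEnei] can be rewritten under the binders over coalitions. *)
case=> _ /funext AEnei; case: p => /=.
- by rewrite /nm_serial -AEnei; exact: am_serialP.
- by rewrite /nm_independent -AEnei; exact: am_independentP.
- by rewrite /nm_deterministic -AEnei; exact: am_deterministicP.
Qed.

Unset Implicit Arguments.

Theorem theorem4p13 (AG : finType) (AG_nonempty : (0 < #|AG|)%N)
    (AP : countType) (ST AC : Type)
    (M : action_model AG AP ST AC) (N : neighborhood_model AG AP ST)
    (MN : z_representable M N) (X : ES) :
  is_action_X_model X M <-> is_neighborhood_X_model X N.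
Proof.
by split=> hasX p Xp; apply/(z_representable_has p MN); exact: hasX.
Qed.
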